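(* Let $(G_\alpha)_{\alpha>0}$ be a strongly continuous contraction resolvent on a real Hilbert space $H$ with inner product $(\cdot\,|\,\cdot)$, let $(L,D(L))$ be its generator, and let $(L^\ast,D(L^\ast))$ be the generator of the adjoint resolvent $(G_\alpha^\ast)_{\alpha>0}$. Suppose there exists $D_0\subseteq H$ which is a core for $(L,D(L))$, for $(L^\ast,D(L^\ast))$ and for $(L_s,D(L_s))$, where $(L_s,D(L_s))$ is a self-adjoint negative definite extension of the operator $\frac{L+L^\ast}{2}$ defined on $D_0$. Then $$(u\,|\,G_\alpha u)\,\le\,\big(u\,\big|\,(\alpha-L_s)^{-1}u\big),\qquad u\in H,$$ for every $\alpha>0$.
   Context: The generator $(L,D(L))$ of a strongly continuous contraction resolvent $(G_\alpha)_{\alpha>0}$ is the densely defined closed operator with $G_\alpha=(\alpha-L)^{-1}$ for all $\alpha>0$. $G_\alpha^\ast$ is the adjoint of $G_\alpha$; the family $(G_\alpha^\ast)_{\alpha>0}$ is also a strongly continuous contraction resolvent on $H$. An operator $A$ is called negative definite if $(Av\,|\,v)\le0$ for all $v$ in its domain. If $D_0$ is a core for both $(L,D(L))$ and $(L^\ast,D(L^\ast))$, then $\frac{L+L^\ast}{2}$ on $D_0$ is symmetric, negative definite and densely defined, so self-adjoint negative definite extensions exist. *)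

(* Defs.v *)
From mathcomp Require Import all_boot all_order all_algebra.
From mathcomp Require Import all_classical all_reals all_analysis.
Import Order.TTheory GRing.Theory Num.Theory numFieldNormedType.Exports.

Set Implicit Arguments.
Unset Strict Implicit.
Unset Printing Implicit Defensive.

Local Open Scope classical_set_scope.
Local Open Scope ring_scope.

(* A real Hilbert space is a complete normed module together with a symmetric
   positive definite bilinear form that induces its norm. *)
Definition induces_norm (R : realType) (H : completeNormedModType R)
    (ip : {dot H for idfun}) : Prop :=
  forall u : H, `|u| ^+ 2 = ip u u.

(* A possibly unbounded operator: only the values of [act] on [dom] are
   meaningful, so operators are compared through [extends], never by [=]. *)
Record operator (R : realType) (H : completeNormedModType R) := Operator {
  dom : set H;
  act :> H -> H
}.

Section Operators.
Context {R : realType} {H : completeNormedModType R}.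
Implicit Types (A B : operator H) (D : set H).

Definition subspace D : Prop :=
  D 0 /\ forall (a : R) (u v : H), D u -> D v -> D (a *: u + v).

Definition linear_operator A : Prop :=
  subspace (dom A) /\
  forall (a : R) (u v : H), dom A u -> dom A v ->
    A (a *: u + v) = a *: A u + A v.

Definition densely_defined A : Prop := dense (dom A).

Definition graph A : set (H * H) := [set p | dom A p.1 /\ p.2 = A p.1].

Definition closed_operator A : Prop := closed (graph A).

Definition extends B A : Prop :=
  dom A `<=` dom B /\ forall u, dom A u -> B u = A u.

Definition restriction A D : operator H := Operator D A.

(* [D] is a core for [A]: a linear subspace of the domain such that the
   closure of the restriction of [A] to [D] is [A]. *)
Definition core D A : Prop :=
  [/\ subspace D, D `<=` dom A &
      closure (graph (restriction A D)) = graph A].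

(* [invertible a A] : a - A maps the domain of A bijectively onto H.
   [resolvent a A] is (a - A)^-1, with values specified only in that case. *)
Definition invertible (a : R) A : Prop :=
  set_bij (dom A) [set: H] (fun u => a *: u - A u).

Definition resolvent (a : R) A : H -> H :=
  'pinv_(fun=> 0) (dom A) (fun u => a *: u - A u).

Definition sc_contraction_resolvent (G : R -> H -> H) : Prop :=
  [/\ forall a : R, 0 < a -> linear (G a),
      forall a : R, 0 < a -> forall u : H, `|a *: G a u| <= `|u|,
      forall a b : R, 0 < a -> 0 < b ->
        forall u : H, G a u - G b u = (b - a) *: G a (G b u) &
      forall u : H, a *: G a u @[a --> +oo%R] --> u].

Definition generator (G : R -> H -> H) A : Prop :=
  [/\ linear_operator A, densely_defined A, closed_operator A &
      forall a : R, 0 < a -> invertible a A /\ G a =1 resolvent a A].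

Variable ip : {dot H for idfun}.

(* The vector [w] is unique when [A] is densely defined. *)
Definition adjoint A : operator H :=
  Operator
    [set v | exists w : H, forall u, dom A u -> ip (A u) v = ip u w]
    (fun v => xget 0 [set w : H | forall u, dom A u -> ip (A u) v = ip u w]).

Definition self_adjoint A : Prop :=
  [/\ linear_operator A, densely_defined A,
      extends (adjoint A) A & extends A (adjoint A)].

Definition negative_definite A : Prop := forall v, dom A v -> ip (A v) v <= 0.

Definition adjoint_family (G : R -> H -> H) : R -> H -> H :=
  fun a => adjoint (Operator [set: H] (G a)).

(* (A + B)/2 on [D] *)
Definition half_sum A B D : operator H :=
  Operator D (fun u => 2^-1 *: (A u + B u)).

End Operators.

(* Main.v *)
Require Import Defs.
From mathcomp Require Import all_boot all_order all_algebra.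
From mathcomp Require Import all_classical all_reals all_analysis.
From mathcomp Require Import ring lra.
Import Order.TTheory GRing.Theory Num.Theory numFieldNormedType.Exports.

Local Open Scope classical_set_scope.
Local Open Scope ring_scope.

(** The inequality follows from the variational characterisation of
    (a - Ls)^-1.  Write E v := ((a - Ls) v | v), a nonnegative quadratic form
    on the domain of Ls, and s := (a - Ls)^-1 u.  Expanding E (v - s) >= 0
    with the symmetry of Ls gives
      2 (u | v) - E v <= (u | s)  for every v in the domain of Ls.
    On D0 the form E agrees with v |-> ((a - L) v | v), because Ls is there the
    symmetric part of L.  If w := G a u were in D0, then (a - L) w = u and
    taking v := w would give (u | w) <= (u | s), the claim.  In general w is
    only in the domain of L, but both sides of the inequality, with E v
    replaced by ((a - L) v | v), depend continuously on the pair (v, L v), and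
    D0 is a core for L, so the inequality extends to w.

    Two facts feed this argument.

    - E v = ((a - L) v | v) on D0 needs (L v | w) = (v | Lstar w)
      ([generator_adjoint]).  It follows from the adjointness of the bounded
      operators G 1 and its adjoint, with L and Lstar recovered from them.

    - The vector s exists because a - Ls is onto
      ([self_adjoint_negative_invertible]).  Its range is closed, since
      a |v| <= |(a - Ls) v| and Ls is closed; a vector orthogonal to the range
      is an eigenvector of Ls for the eigenvalue a > 0, hence zero.  The
      orthogonal projection onto a closed subspace concludes. *)

(** * The inner product *)

Section InnerProduct.
Context {R : realType} {H : completeNormedModType R} (ip : {dot H for idfun}).
Context (ip_norm : induces_norm ip).

Lemma ipC u v : ip u v = ip v u.
Proof. by rewrite hermC expr0 mul1r. Qed.

Lemma ip_ge0 u : 0 <= ip u u.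
Proof. by rewrite -ip_norm exprn_ge0. Qed.

Lemma ip_eq0 u : ip u u = 0 -> u = 0.
Proof. by rewrite -ip_norm => /eqP; rewrite expf_eq0 /= normr_eq0 => /eqP. Qed.

(** The generic bilinearity lemmas also match scalar multiplication in [R], and
    would distribute its products; this multirule only rewrites under [ip]. *)
Lemma ip_bilin :
  (((forall u v w : H, ip (u + v)%R w = (ip u w + ip v w)%R) *
    (forall u v w : H, ip u (v + w)%R = (ip u v + ip u w)%R)) *
   ((forall u v : H, ip (- u)%R v = (- ip u v)%R) *
    (forall u v : H, ip u (- v)%R = (- ip u v)%R)) *
   ((forall c (u v : H), ip (c *: u)%R v = (c * ip u v)%R) *
    (forall c (u v : H), ip u (c *: v)%R = (c * ip u v)%R)))%type.
Proof.
split; [split; split=> *|split=> *];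
  by rewrite ?(linearDl, linearDr, linearNl, linearNr,
    linearZl_LR, linearZr_LR).
Qed.

(** As the norm is continuous, this identity makes [ip] jointly continuous. *)
Lemma polarization u v : ip u v = 4^-1 * (`|u + v| ^+ 2 - `|u - v| ^+ 2).
Proof.
rewrite !ip_norm !ip_bilin /= (ipC v u).
by field.
Qed.

Lemma cvg_ip {T : Type} {F : set_system T} {FF : Filter F} (f g : T -> H) x y :
  f t @[t --> F] --> x -> g t @[t --> F] --> y ->
  ip (f t) (g t) @[t --> F] --> ip x y.
Proof.
move=> fx gy; rewrite polarization.
under eq_fun do rewrite polarization.
have sqr h z : h t @[t --> F] --> z ->
    `|h t : H| ^+ 2 @[t --> F] --> `|z : H| ^+ 2.
  by move=> /cvg_norm hz; rewrite expr2; under eq_fun do rewrite expr2;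
    exact: cvgM.
apply: cvgM; first exact: cvg_cst.
by apply: cvgB; apply: sqr; [exact: cvgD|exact: cvgB].
Qed.

(** * Orthogonal projection *)

(** An abstract well-posed minimisation problem: if almost minimisers of [phi]
    are close to each other, they form a Cauchy filter, and completeness turns
    it into a limit. It serves twice, to find the nearest point of a closed
    subspace and to solve an equation approximately solvable in [D]. *)
Lemma exists_minimizing_filter (D : set H) (phi : H -> R) :
  (forall e, 0 < e -> exists2 v, D v & phi v < e) ->
  (forall e, 0 < e -> exists2 d, 0 < d &
     forall u v, D u -> D v -> phi u < d -> phi v < d -> `|u - v| < e) ->
  exists p : H, exists2 F : set_system H, ProperFilter F /\ F --> p &
    forall e, 0 < e -> F [set v | D v /\ phi v < e].
Proof.
move=> phi_small phi_modulus.
pose B (e : R) := [set v | D v /\ phi v < e].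
pose F := filter_from [set e : R | 0 < e] B.
have FB e : 0 < e -> F (B e) by move=> e0; exists e.
have FF : ProperFilter F.
  apply: filter_from_proper; last first.
    by move=> e /phi_small[v Dv phiv]; exists v.
  apply: filter_from_filter; first by exists 1 => /=.
  move=> d e d0 e0; exists (Num.min d e); first by rewrite /= lt_min d0.
  by move=> v [Dv]; rewrite lt_min => /andP[]; split; split.
have /cauchy_cvg Fcvg : cauchy F.
  apply: cauchy_exP => e e0.
  have [d d0 modulus] := phi_modulus _ e0.
  have [u Du phiu] := phi_small _ d0.
  exists u; exists d => // v [Dv phiv]; rewrite -ball_normE /=; exact: modulus.
by exists (lim F); exists F.
Qed.

(** The point of [S] nearest to [f] exists by completeness, since the
    parallelogram law forces almost nearest points together; minimality along
    the lines through it gives orthogonality. *)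
Lemma orthogonal_projection (S : set H) (f : H) :
  Defs.subspace S -> closed S ->
  exists2 p, S p & forall s, S s -> ip (f - p) s = 0.
Proof.
move=> [S0 Slin] Scl.
pose E := [set `|f - s| ^+ 2 | s in S].
have E_inf : has_inf E.
  split; first by exists (`|f - 0| ^+ 2), 0.
  by exists 0 => _ [s _ <-]; rewrite exprn_ge0.
have inf_le s : S s -> inf E <= `|f - s| ^+ 2.
  by move=> Ss; apply: ge_inf; [case: E_inf|exists s].
have [||p [F [FF Fp] Fmin]] :=
    @exists_minimizing_filter S (fun s => `|f - s| ^+ 2 - inf E).
- move=> e e0; have [_ [s Ss <-] lt_s] := inf_adherent e0 E_inf.
  by exists s => //; rewrite ltrBlDl.
(* The midpoint m of u and v is at squared distance at least inf E from f, so
   the parallelogram law bounds |u - v|^2 by 4 d when u and v are within d of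
   the infimum: hence the choice d = e^2 / 4. *)
- move=> e e0; exists (e ^+ 2 / 4); first by rewrite divr_gt0 // exprn_gt0.
  move=> u v Su Sv ltu ltv.
  rewrite -(@ltr_pXn2r _ 2) ?nnegrE ?normr_ge0 ?(ltW e0) //.
  pose m := 2^-1 *: (u + v).
  have Sm : S m.
    have Suv : S (u + v) by rewrite -[u]scale1r; exact: Slin.
    by rewrite -[m]addr0; exact: Slin.
  have := inf_le _ Sm.
  suff -> : `|u - v| ^+ 2 =
      2 * `|f - u| ^+ 2 + 2 * `|f - v| ^+ 2 - 4 * `|f - m| ^+ 2 by lra.
  rewrite !ip_norm /m !ip_bilin /=.
  rewrite (ipC v u) (ipC u f) (ipC v f).
  by field.
have Sp : S p.
  apply: (closed_cvg S Scl _ p Fp).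
  by apply: filterS (Fmin 1 ltr01) => v [].
have p_min : `|f - p| ^+ 2 <= inf E.
  apply/ler_addgt0Pr => e e0.
  have cl : closed [set v : H | `|f - v| ^+ 2 <= inf E + e].
    apply: (@preimage_closed _ _ (fun v : H => `|f - v| ^+ 2)
      [set x | x <= inf E + e]); last exact: closed_le.
    move=> v _.
    rewrite /continuous_at ip_norm; under eq_fun do rewrite ip_norm.
    by apply: cvg_ip; apply: cvgB; (exact: cvg_cst || exact: cvg_id).
  apply: (closed_cvg _ cl _ p Fp).
  by apply: filterS (Fmin e e0) => v [_] /=; lra.
exists p => // s Ss.
have [s0|ss_neq0] := eqVneq (ip s s) 0.
  by rewrite (ip_eq0 _ s0) linear0r.
have s_gt0 : 0 < ip s s by rewrite lt0r ss_neq0 ip_ge0.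
(* This c minimises the squared distance from f to p + c s, with minimum
   |f - p|^2 - (f - p | s)^2 / (s | s). *)
pose c := ip (f - p) s / ip s s.
have := inf_le (c *: s + p) (Slin c _ _ Ss Sp).
have -> : f - (c *: s + p) = (f - p) - c *: s by rewrite opprD addrCA addrC.
move=> /(le_trans p_min); rewrite !ip_norm.
move: (f - p) @c => g c.
rewrite !ip_bilin /= (ipC s g).
rewrite [leRHS](_ : _ = ip g g - ip g s ^+ 2 / ip s s);
  last by rewrite /c; field.
rewrite lerBrDl gerDr => le0.
have := divr_ge0 (sqr_ge0 (ip g s)) (ltW s_gt0) => ge0.
have /eqP : ip g s ^+ 2 / ip s s = 0 by apply/le_anti/andP.
by rewrite mulf_eq0 invr_eq0 (negPf ss_neq0) orbF sqrf_eq0 => /eqP.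
Qed.

(** * Adjoints and self-adjoint operators *)

Lemma dense_ortho_eq0 (D : set H) z :
  dense D -> (forall u, D u -> ip u z = 0) -> z = 0.
Proof.
move=> dD Dz; apply: ip_eq0; apply: contrapT => zz.
have cl : closed [set u : H | ip u z = 0].
  apply: (@preimage_closed _ _ (ip^~ z) [set 0]); last exact: closed_eq.
  by move=> u _; apply: cvg_ip; [exact: cvg_id|exact: cvg_cst].
have [|u [/= uz Du]] := dD (~` [set u : H | ip u z = 0]) _ (closed_openC cl).
  by exists z.
by apply: uz; exact: Dz.
Qed.

Lemma adjointP (A : operator H) u v : dom (adjoint ip A) v -> dom A u ->
  ip (A u) v = ip u (adjoint ip A v).
Proof. by move=> [w Aw]; move: u; rewrite /=; case: xgetP => [_ _|/(_ w)] //. Qed.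

Lemma adjointE (A : operator H) v w : densely_defined A ->
  (forall u, dom A u -> ip (A u) v = ip u w) -> adjoint ip A v = w.
Proof.
move=> dA Aw; apply/eqP; rewrite -subr_eq0; apply/eqP.
apply: (dense_ortho_eq0 (dom A)) => // u Au.
by rewrite linearBr /= -Aw // adjointP ?subrr //; exists w.
Qed.

Lemma self_adjoint_sym (A : operator H) u v : self_adjoint ip A ->
  dom A u -> dom A v -> ip (A u) v = ip u (A v).
Proof.
by move=> [_ _ [sub AE] _] Au Av; rewrite -(AE v) // adjointP //; exact: sub.
Qed.

(** Maximality of a self-adjoint operator: its graph contains every pair that
    satisfies the symmetry relation against the domain. *)
Lemma self_adjoint_graph (A : operator H) v w : self_adjoint ip A ->
  (forall u, dom A u -> ip (A u) v = ip u w) -> dom A v /\ A v = w.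
Proof.
move=> [_ dA _ [sub AE]] Aw.
have Av : dom (adjoint ip A) v by exists w.
by split; [exact: sub|rewrite AE //; exact: adjointE].
Qed.

(** By maximality the graph is an intersection of kernels of continuous
    functionals. *)
Lemma self_adjoint_closed (A : operator H) :
  self_adjoint ip A -> closed_operator A.
Proof.
move=> sA.
rewrite /closed_operator; have -> : graph A = \bigcap_(u in dom A)
    [set q : H * H | ip (A u) q.1 - ip u q.2 = 0].
  apply/seteqP; split => [[v _] [/= Av ->] u Au /=|[v w] /= Aw].
    by rewrite self_adjoint_sym ?subrr.
  have [] := self_adjoint_graph A v w sA; last by [].
  by move=> u Au; apply/eqP; rewrite -subr_eq0; apply/eqP; exact: Aw.
apply: closed_bigI => u _.
apply: (@preimage_closed _ _
  (fun q : H * H => ip (A u) q.1 - ip u q.2) [set 0]);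
  last exact: closed_eq.
move=> q _; apply: cvgB; apply: cvg_ip;
  by [exact: cvg_cst|exact: cvg_fst|exact: cvg_snd].
Qed.

(** * Surjectivity of [a - A] for negative definite [A] *)

Section Shift.
Context (A : operator H) (A_lin : linear_operator A).

Lemma dom0 : dom A 0. Proof. by case: A_lin => -[]. Qed.

Lemma dom_linear c u v : dom A u -> dom A v -> dom A (c *: u + v).
Proof. by case: A_lin => -[_ +] _; apply. Qed.

Lemma shift_linear (a c : R) u v : dom A u -> dom A v ->
  a *: (c *: u + v) - A (c *: u + v) = c *: (a *: u - A u) + (a *: v - A v).
Proof.
case: A_lin => _ lin Au Av.
by rewrite lin // opprD scalerDr addrACA scalerBr !scalerA mulrC.
Qed.

Lemma domB u v : dom A u -> dom A v -> dom A (u - v).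
Proof. by move=> Au Av; rewrite addrC -scaleN1r; exact: dom_linear. Qed.

Lemma shiftB a u v : dom A u -> dom A v ->
  a *: (u - v) - A (u - v) = (a *: u - A u) - (a *: v - A v).
Proof.
by move=> Au Av; rewrite [u - v]addrC -scaleN1r shift_linear // scaleN1r addrC.
Qed.

Lemma range_subspace a : Defs.subspace [set a *: u - A u | u in dom A].
Proof.
split.
  exists 0; first exact: dom0.
  by have := shiftB a 0 0 dom0 dom0; rewrite !subrr.
by move=> c _ _ [u Au <-] [v Av <-]; exists (c *: u + v);
  [exact: dom_linear|exact: shift_linear].
Qed.

Context (A_neg : negative_definite ip A).

Lemma shift_ge0 (a : R) v : 0 < a -> dom A v -> 0 <= ip (a *: v - A v) v.
Proof.
move=> a0 /A_neg Av; rewrite !ip_bilin /= subr_ge0 (le_trans Av) //.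
by rewrite mulr_ge0 ?ip_ge0 ?ltW.
Qed.

(** In |a v - A v|^2 = a^2 |v|^2 - 2 a (A v | v) + |A v|^2 the last two terms
    are nonnegative. *)
Lemma shift_lower_bound (a : R) v : 0 < a -> dom A v ->
  a * `|v| <= `|a *: v - A v|.
Proof.
move=> a0 /A_neg Av.
rewrite -(@ler_pXn2r _ 2) ?nnegrE ?mulr_ge0 ?normr_ge0 ?(ltW a0) //.
rewrite exprMn !ip_norm !ip_bilin /=.
rewrite (ipC v (A v)).
have := ip_ge0 (A v).
have : a * ip (A v) v <= 0 by rewrite pmulr_rle0.
lra.
Qed.

(** If a v - A v tends to f, the lower bound makes the vectors v Cauchy; their
    limit belongs to the domain because the graph of [A] is closed. *)
Lemma range_closed (a : R) : 0 < a -> closed_operator A ->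
  closed [set a *: u - A u | u in dom A].
Proof.
move=> a0 clA f clf.
have [||p [F [FF Fp] Ff]] :=
    @exists_minimizing_filter (dom A) (fun v => `|f - (a *: v - A v)|).
- move=> e e0.
  have [|_ [[v Av <-]]] := clf (ball f e); first exact: nbhsx_ballx.
  by rewrite -ball_normE /=; exists v.
- move=> e e0; exists (a * e / 2); first by rewrite divr_gt0 ?mulr_gt0.
  move=> u v Au Av fu fv; rewrite -(ltr_pM2l a0).
  apply: le_lt_trans (shift_lower_bound _ _ a0 (domB _ _ Au Av)) _.
  rewrite shiftB // -(subrKA f) (le_lt_trans (ler_normD _ _)) //.
  by rewrite [X in X + _]distrC; lra.
have Ffp : a *: v - A v @[v --> F] --> f.
  apply/cvgrPdist_lt => e e0.
  by apply: filterS (Ff e e0) => v [].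
have : graph A (p, a *: p - f).
  apply: (closed_cvg (graph A) clA (u_ := fun v => (v, A v)) (F := F)).
    by apply: filterS (Ff 1 ltr01) => v [].
  apply: cvg_pair => //=.
  have -> : A = (fun v => a *: v - (a *: v - A v)) :> (H -> H).
    by apply/funext => v; rewrite opprB addrC subrK.
  by apply: cvgB => //; apply: cvgZl_tmp.
move=> [/= Ap eqp]; exists p => //.
by rewrite -eqp opprB addrC subrK.
Qed.

End Shift.

(** A vector z orthogonal to the range satisfies (A u | z) = (u | a z) for all u
    in the domain, so A z = a z by maximality; as [A] is negative definite and
    a > 0, z vanishes.  The closed range is therefore everything. *)
Lemma self_adjoint_negative_invertible (A : operator H) (a : R) : 0 < a ->
  self_adjoint ip A -> negative_definite ip A -> invertible a A.
Proof.
move=> a0 sA nA; have [lA dA _ _] := sA.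
split.
- by [].
- move=> u v /set_mem Au /set_mem Av eq_uv.
  have := shift_lower_bound _ nA a (u - v) a0 (domB _ lA _ _ Au Av).
  rewrite shiftB // eq_uv subrr normr0 pmulr_rle0 // normr_le0.
  by rewrite subr_eq0 => /eqP.
- move=> f _.
  have [_ [v Av <-] orth] := orthogonal_projection _ f (range_subspace _ lA a)
    (range_closed _ lA nA _ a0 (self_adjoint_closed _ sA)).
  move: orth; move def_z: (f - _) => z orth.
  have [u Au|Az eqz] := self_adjoint_graph A z (a *: z) sA.
    have := orth (a *: u - A u) (ex_intro2 _ _ u Au erefl).
    rewrite ipC !ip_bilin => /eqP.
    by rewrite subr_eq0 => /eqP ->.
  suff z0 : z = 0.
    by exists v => //; apply/eqP; rewrite eq_sym -subr_eq0 def_z z0.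
  apply: ip_eq0; apply/le_anti; rewrite ip_ge0 andbT.
  by have := nA _ Az; rewrite eqz linearZl_LR /= pmulr_rle0.
Qed.

(** * Resolvents and generators *)

Lemma resolventP (A : operator H) a f : invertible a A ->
  dom A (resolvent a A f) /\
  a *: resolvent a A f - A (resolvent a A f) = f.
Proof.
move=> bij; have [_ _ surj] := bij; split.
  have [+ _ _] : set_bij setT (dom A) (resolvent a A) by exact: bijpinv_bij.
  exact.
have fK : {in setT, cancel (resolvent a A) (fun u => a *: u - A u)}.
  exact: surjpK.
by apply: fK; rewrite inE.
Qed.

Lemma resolventK (A : operator H) a v : invertible a A -> dom A v ->
  resolvent a A (a *: v - A v) = v.
Proof. by move=> [_ inj _] Av; apply: pinvKV => //; rewrite inE. Qed.

(** With x := w - Lstar w one has w = (G 1)^* x and G 1 (L v) = G 1 v - v, so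
    (L v | w) = (G 1 (L v) | x) = (G 1 v - v | x) = (v | w) - (v | x)
    = (v | Lstar w). *)
Lemma generator_adjoint (G : R -> H -> H) (L Lstar : operator H) v w :
  sc_contraction_resolvent G -> generator G L ->
  generator (adjoint_family ip G) Lstar ->
  dom L v -> dom Lstar w -> ip (L v) w = ip v (Lstar w).
Proof.
move=> [Glin _ _ _] [_ _ _ Lres] [_ _ _ Lsres] Lv Lw.
have [Linv GE] := Lres 1 ltr01.
have [Lsinv GsE] := Lsres 1 ltr01.
pose x := 1 *: w - Lstar w.
pose G1 := Operator setT (G 1).
have dG1 : densely_defined G1 by move=> O O0 _; rewrite setIT.
have Gsx : adjoint ip G1 x = w.
  by rewrite -[LHS]/(adjoint_family ip G 1 x) GsE resolventK.
have Gs0 : adjoint ip G1 0 = 0.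
  by apply: adjointE => // u _; rewrite !linear0r.
(* [adjoint] is a choice function, zero where no adjoint vector exists.  On such
   an x it would take the same value as on 0, against the injectivity of the
   resolvent of Lstar: so the adjoint of G 1 is genuine at x. *)
have dom_x : dom (adjoint ip G1) x.
  apply: contrapT => ndom.
  have G0 : adjoint ip G1 x = 0.
    rewrite /=; case: xgetP => // w' _ Hw'; exfalso; apply: ndom; by exists w'.
  have [_ eqx] := resolventP _ _ x Lsinv.
  have [_ eq0] := resolventP _ _ 0 Lsinv.
  have x0 : x = 0.
    rewrite -eqx -{}eq0 -!GsE /adjoint_family -/G1 G0 Gs0 //.
  by apply: ndom; rewrite x0; exists 0 => u _; rewrite !linear0r.
have Gv : G 1 (L v) = G 1 v - v.
  have GLv : G 1 (1 *: v - L v) = v by rewrite GE resolventK.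
  have {1}-> : L v = -1 *: (1 *: v - L v) + v.
    by rewrite scaleN1r scale1r opprB subrK.
  by rewrite Glin // GLv scaleN1r addrC.
have pair u : ip (G 1 u) x = ip u w by rewrite -Gsx; exact: (adjointP G1).
rewrite -pair Gv linearBl /= pair /x scale1r linearBr /=; lra.
Qed.

End InnerProduct.

Theorem corollary2p6 (R : realType) (H : completeNormedModType R)
    (ip : {dot H for idfun}) (ip_norm : induces_norm ip)
    (G : R -> H -> H) (L Lstar Ls : operator H) (D0 : set H)
    (G_resolvent : sc_contraction_resolvent G)
    (L_generator : generator G L)
    (Lstar_generator : generator (adjoint_family ip G) Lstar)
    (Ls_self_adjoint : self_adjoint ip Ls)
    (Ls_negative : negative_definite ip Ls)
    (Ls_extends : extends Ls (half_sum L Lstar D0))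
    (D0_core_L : core D0 L)
    (D0_core_Lstar : core D0 Lstar)
    (D0_core_Ls : core D0 Ls)
    (a : R) (a_gt0 : 0 < a) :
  invertible a Ls /\ forall u : H, ip u (G a u) <= ip u (resolvent a Ls u).
Proof.
have Ls_inv : invertible a Ls by exact: self_adjoint_negative_invertible.
split=> // u.
have [_ _ _ /(_ _ a_gt0)[L_inv GE]] := L_generator.
have [] := resolventP _ a u L_inv; rewrite -GE.
set w := G a u => Lw eqw.
have [] := resolventP _ a u Ls_inv; set s := resolvent a Ls u => Lss eqs.
have [Ls_lin _ _ _] := Ls_self_adjoint.
(* (u | s) - (2 (u | v) - ((a - L) v | v)) as a function of (v, L v): it is
   continuous, nonnegative on D0, and equal to (u | s) - (u | w) at w. *)
pose gap (q : H * H) := ip (a *: q.1 - q.2) q.1 - 2 * ip u q.1 + ip u s.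
have gap_closed : closed [set q | 0 <= gap q].
  apply: (@preimage_closed _ _ gap [set x | 0 <= x]); last exact: closed_ge.
  move=> q _; have cvg1 : q'.1 @[q' --> q] --> q.1 by exact: cvg_fst.
  have cvg2 : q'.2 @[q' --> q] --> q.2 by exact: cvg_snd.
  apply: cvgD; last exact: cvg_cst.
  apply: cvgB; last first.
    by apply: cvgM; [exact: cvg_cst|apply: cvg_ip => //; exact: cvg_cst].
  by apply: cvg_ip => //; apply: cvgB => //; apply: cvgZl_tmp.
have gap_core : graph (restriction L D0) `<=` [set q | 0 <= gap q].
  move=> [v _] [/= D0v ->].
  have [_ D0L _] := D0_core_L; have [_ D0Ls _] := D0_core_Lstar.
  have [D0dom LsE] := Ls_extends.
  have Lsv : dom Ls v by exact: D0dom.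
  have diag : ip (L v) v = ip (Ls v) v.
    rewrite (LsE v D0v) /= !(ip_bilin ip) /=.
    have := generator_adjoint _ ip_norm _ _ _ v v G_resolvent L_generator
      Lstar_generator (D0L _ D0v) (D0Ls _ D0v).
    by rewrite (ipC _ v (Lstar v)) => <-; field.
  have sym : ip (a *: v - Ls v) s = ip u v.
    rewrite -eqs (ipC _ _ v) !(ip_bilin ip) /=.
    by rewrite (self_adjoint_sym ip).
  (* the form E at v - s *)
  have := shift_ge0 _ ip_norm _ Ls_negative a _ a_gt0
    (domB _ Ls_lin _ _ Lsv Lss).
  move: sym; rewrite shiftB // eqs /gap /= !(ip_bilin ip) diag.
  lra.
have [_ _ L_core] := D0_core_L.
have : graph L (w, L w) by [].
rewrite -L_core => /(closureS gap_core).
rewrite -(iffLR (closure_id _) gap_closed) /gap /= eqw; lra.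
Qed.
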